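(* Let $\mathfrak R$ be an associative unital algebra over $\mathbb C$. Let $A\in\mathrm{End}(\mathbb C^n\otimes\mathbb C^n)$, $B\in\mathrm{End}(\mathbb C^m\otimes\mathbb C^m)$ and $C\in\mathrm{End}(\mathbb C^k\otimes\mathbb C^k)$ be idempotents. Let $M$ and $N$ be $n\times m$ and $m\times k$ matrices over $\mathfrak R$ respectively. Suppose that $M$ is an $(A,B)$-Manin matrix, that $N$ is a $(B,C)$-Manin matrix, and that $$[M^i_j,N^{j'}_l]=0\qquad\text{for all } i=1,\dots,n,\ j,j'=1,\dots,m,\ l=1,\dots,k.$$ Then the $n\times k$ matrix $K=MN$ is an $(A,C)$-Manin matrix over $\mathfrak R$.
   Context: For an $n\times m$ matrix $M=(M^i_j)$ over $\mathfrak R$, regarded as an element of $\mathfrak R\otimes\mathrm{Hom}(\mathbb C^m,\mathbb C^n)$, the product $M^{(1)}M^{(2)}\in\mathfrak R\otimes\mathrm{Hom}(\mathbb C^m\otimes\mathbb C^m,\mathbb C^n\otimes\mathbb C^n)$ has entries $(M^{(1)}M^{(2)})^{ij}_{kl}=M^i_kM^j_l$. For idempotents $A\in\mathrm{End}(\mathbb C^n\otimes\mathbb C^n)$, $B\in\mathrm{End}(\mathbb C^m\otimes\mathbb C^m)$, an $n\times m$ matrix $M$ over $\mathfrak R$ is called an $(A,B)$-Manin matrix if $A\,M^{(1)}M^{(2)}(1-B)=0$. *)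

(* Defs.v *)
From mathcomp Require Import all_boot all_order all_algebra.
From mathcomp Require Import reals complex mxtens.
Set Implicit Arguments.
Unset Strict Implicit.
Unset Printing Implicit Defensive.
Import GRing.Theory.
Local Open Scope ring_scope.

(* An associative unital algebra is a ring with a central ring morphism from
   the scalars, [c |-> c . 1].  The library's [algType F] additionally imposes
   1 != 0; the zero algebra is allowed here. *)
Record unitalAlgebra (F : pzRingType) := UnitalAlgebra {
  algebra_ring :> pzRingType;
  algebra_map : {rmorphism F -> algebra_ring};
  algebra_mapC : forall (c : F) (x : algebra_ring),
    algebra_map c * x = x * algebra_map c
}.

Lemma in_algC (F : pzRingType) (A : algType F) (c : F) (x : A) :
  in_alg A c * x = x * in_alg A c.
Proof. by rewrite mulr_algl mulr_algr. Qed.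

Definition unitalAlgebra_of_algType (F : pzRingType) (A : algType F) :
  unitalAlgebra F := UnitalAlgebra (@in_algC F A).

(* Operators on F^n (x) F^n are matrices indexed by the pairs
   [mxtens_index (i, j)].  [M *t M] is the product M^(1) M^(2): its entry in
   row (i, j) and column (k, l) is [M i k * M j l], in this order. *)
Definition is_Manin (F : pzRingType) (Rr : unitalAlgebra F) (n m : nat)
    (A : 'M[F]_(n * n)) (B : 'M[F]_(m * m)) (M : 'M[Rr]_(n, m)) : Prop :=
  map_mx (algebra_map Rr) A *m (M *t M)
    *m (1%:M - map_mx (algebra_map Rr) B) = 0.

(* Main.v *)
Require Import Defs.
From mathcomp Require Import all_boot all_order all_algebra.
From mathcomp Require Import reals complex mxtens.
Import GRing.Theory.
Local Open Scope ring_scope.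

(** Since the entries of [M] and [N] commute, [K *t K] for [K = M *m N] splits as
    [(M *t M) *m (N *t N)]. The condition on [M] lets [B] be inserted between these factors; the one
    on [N] then kills the product. *)

(* Noncommutative version of mathcomp's [tensmx_mul]: only the factors [N] and
   [P], which trade places, have to commute. *)
Lemma tensmx_mul_comm (S : pzRingType) (n m k p q r : nat)
    (M : 'M[S]_(n, m)) (N : 'M[S]_(m, k)) (P : 'M[S]_(p, q)) (Q : 'M[S]_(q, r)) :
    (forall j l i j', N j l * P i j' = P i j' * N j l) ->
  (M *m N) *t (P *m Q) = (M *t P) *m (N *t Q).
Proof.
(* [mulr_sum] merges both sums into one over ['I_(m * q)], the inner index on the right. *)
move=> cNP; apply/matrixP => i j; rewrite !mxE mulr_sum.
by apply: eq_bigr => h _; rewrite !mxE -!mulrA; congr (_ * _); rewrite !mulrA cNP.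
Qed.

Theorem proposition2p27 (R : realType) (Rr : unitalAlgebra R[i]) (n m k : nat)
    (A : 'M[R[i]]_(n * n)) (B : 'M[R[i]]_(m * m)) (C : 'M[R[i]]_(k * k))
    (M : 'M[Rr]_(n, m)) (N : 'M[Rr]_(m, k))
    (idemA : A *m A = A) (idemB : B *m B = B) (idemC : C *m C = C)
    (ManinM : is_Manin A B M) (ManinN : is_Manin B C N)
    (commMN : forall (i : 'I_n) (j j' : 'I_m) (l : 'I_k),
       M i j * N j' l - N j' l * M i j = 0) :
  is_Manin A C (M *m N).
Proof.
rewrite /is_Manin tensmx_mul_comm; last first.
  by move=> j l i j'; apply/esym/eqP; rewrite -subr_eq0 commMN.
(* Vanishing against [1 - B] means that [A *m (M *t M)] absorbs [B] on the right. *)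
move: ManinM => /eqP; rewrite mulmxBr mulmx1 subr_eq0 => /eqP absorbB.
by rewrite [X in X *m _]mulmxA absorbB -!mulmxA [X in _ *m (_ *m X)]mulmxA ManinN !mulmx0.
Qed.
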